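(* Let $\mathsf{CS}$ be a constant specification for $\mathsf{LP}$. Every full $\mathsf{LP}_{\mathsf{CS}}$ algebra is isomorphic to a full $\mathsf{LP}_{\mathsf{CS}}$ set algebra.
   Context: **Language.** Let $\mathsf{Const}$, $\mathsf{Var}$, $\mathsf{Prop}$ be the sets of proof constants, proof variables and propositional atoms. Terms ($\mathsf{Tm}$) and formulas ($\mathsf{Fm}$) are given by $s,t ::= c \mid x \mid s+t \mid s\cdot t \mid\, !t$ and $\varphi,\psi ::= p \mid \bot \mid \neg\varphi \mid \varphi\vee\psi \mid t:\varphi$, with $c\in\mathsf{Const}$, $x\in\mathsf{Var}$, $p\in\mathsf{Prop}$. Abbreviations: $\varphi\to\psi:=\neg\varphi\vee\psi$; $\wedge,\leftrightarrow$ as usual. **Constant specifications.** The axiom schemes of $\mathsf{LP}_\emptyset$ are: $\varphi\to(\varphi\vee\psi)$; $(\varphi\vee\psi)\to(\psi\vee\varphi)$; $(\varphi\vee\varphi)\to\varphi$; $(\varphi\to\psi)\to((\chi\vee\varphi)\to(\chi\vee\psi))$; $\bot\to\varphi$; $s:(\varphi\to\psi)\to(t:\varphi\to(s\cdot t):\psi)$; $(s:\varphi\vee t:\varphi)\to(s+t):\varphi$; $t:\varphi\to\varphi$; $t:\varphi\to\,!t:t:\varphi$. A constant specification $\mathsf{CS}$ for $\mathsf{LP}$ is a set of formulas $c:\varphi$ with $c\in\mathsf{Const}$ and $\varphi$ an axiom instance. **Boolean algebras** are written $(A,0,\ominus,\oplus)$ (least element, complement, join), with $1:=\ominus 0$,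 meet $a\otimes b:=\ominus(\ominus a\oplus\ominus b)$, $a\Rightarrow b:=\ominus a\oplus b$, and $a\le b$ iff $a\Rightarrow b=1$. **Pre $\mathsf{LP}_{\mathsf{CS}}$ algebra:** a tuple $\mathcal{A}=(A,0,\ominus,\oplus,\Box_t)_{t\in\mathsf{Tm}}$ where $(A,0,\ominus,\oplus)$ is a Boolean algebra and each $\Box_t:\mathsf{Fm}\to A$ is a function such that for all $\varphi,\psi\in\mathsf{Fm}$, $s,t\in\mathsf{Tm}$, $c\in\mathsf{Const}$: $\Box_s(\varphi\to\psi)\otimes\Box_t(\varphi)\le\Box_{s\cdot t}(\psi)$; $\Box_s(\varphi)\oplus\Box_t(\varphi)\le\Box_{s+t}(\varphi)$; $\Box_t(\varphi)\le\Box_{!t}(t:\varphi)$; $\Box_c(\varphi)=1$ whenever $c:\varphi\in\mathsf{CS}$. **Assignment.** A valuation $\theta:\mathsf{Prop}\to A$ is extended to $\tilde\theta:\mathsf{Fm}\to A$ by $\tilde\theta(p)=\theta(p)$, $\tilde\theta(\bot)=0$, $\tilde\theta(\neg\varphi)=\ominus\tilde\theta(\varphi)$, $\tilde\theta(\varphi\vee\psi)=\tilde\theta(\varphi)\oplus\tilde\theta(\psi)$, $\tilde\theta(t:\varphi)=\Box_t(\varphi)$. **Full $\mathsf{LP}_{\mathsf{CS}}$ algebra:** a pre $\mathsf{LP}_{\mathsf{CS}}$ algebra such that $\Box_t(\varphi)\le\tilde\theta(\varphi)$ for all $\varphi\in\mathsf{Fm}$, all $t\in\mathsf{Tm}$ and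 all valuations $\theta:\mathsf{Prop}\to A$. **Set algebras.** A set algebra is a subalgebra of a power set algebra $(\mathcal{P}(X),\emptyset,\setminus,\cup)$, where $\setminus$ is complement relative to $X$. A full $\mathsf{LP}_{\mathsf{CS}}$ set algebra is a full $\mathsf{LP}_{\mathsf{CS}}$ algebra whose underlying Boolean algebra is a set algebra. **Isomorphism.** An isomorphism of full $\mathsf{LP}_{\mathsf{CS}}$ algebras $\mathcal{A}\to\mathcal{B}$ is an isomorphism $f$ of the underlying Boolean algebras with $f(\Box_t^{\mathcal{A}}(\varphi))=\Box_t^{\mathcal{B}}(\varphi)$ for all $t\in\mathsf{Tm}$, $\varphi\in\mathsf{Fm}$. *)

(* Defs.v *)
From HB Require Import structures.
From mathcomp Require Import all_boot all_order.
From mathcomp Require Import boolp classical_sets.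

Set Implicit Arguments.
Unset Strict Implicit.
Unset Printing Implicit Defensive.

Import Order.Theory.
Local Open Scope order_scope.

(** * The language of LP *)

Inductive tm (Const Var : Type) : Type :=
  | TConst of Const
  | TVar of Var
  | TSum of tm Const Var & tm Const Var
  | TApp of tm Const Var & tm Const Var
  | TBang of tm Const Var.

Arguments TConst {Const Var}.
Arguments TVar {Const Var}.
Arguments TSum {Const Var}.
Arguments TApp {Const Var}.
Arguments TBang {Const Var}.

(** [FJust t phi] is [t : phi]. *)
Inductive fm (Const Var Atom : Type) : Type :=
  | FAtom of Atom
  | FBot
  | FNeg of fm Const Var Atom
  | FOr of fm Const Var Atom & fm Const Var Atom
  | FJust of tm Const Var & fm Const Var Atom.

Arguments FAtom {Const Var Atom}.
Arguments FBot {Const Var Atom}.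
Arguments FNeg {Const Var Atom}.
Arguments FOr {Const Var Atom}.
Arguments FJust {Const Var Atom}.

Definition FImp {Const Var Atom} (phi psi : fm Const Var Atom) :
  fm Const Var Atom := FOr (FNeg phi) psi.

(** * Constant specifications *)

Inductive LP_axiom (Const Var Atom : Type) : fm Const Var Atom -> Prop :=
  | LP_orI phi psi : LP_axiom (FImp phi (FOr phi psi))
  | LP_orC phi psi : LP_axiom (FImp (FOr phi psi) (FOr psi phi))
  | LP_orxx phi : LP_axiom (FImp (FOr phi phi) phi)
  | LP_orS phi psi chi :
      LP_axiom (FImp (FImp phi psi) (FImp (FOr chi phi) (FOr chi psi)))
  | LP_bot phi : LP_axiom (FImp FBot phi)
  | LP_app s t phi psi :
      LP_axiom (FImp (FJust s (FImp phi psi))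
                     (FImp (FJust t phi) (FJust (TApp s t) psi)))
  | LP_sum s t phi :
      LP_axiom (FImp (FOr (FJust s phi) (FJust t phi)) (FJust (TSum s t) phi))
  | LP_refl t phi : LP_axiom (FImp (FJust t phi) phi)
  | LP_bang t phi :
      LP_axiom (FImp (FJust t phi) (FJust (TBang t) (FJust t phi))).

Definition constant_specification (Const Var Atom : Type)
    (CS : set (fm Const Var Atom)) : Prop :=
  forall chi, CS chi ->
    exists (c : Const) (phi : fm Const Var Atom),
      chi = FJust (TConst c) phi /\ LP_axiom phi.

(** * LP algebras

  A Boolean algebra is a [ctbDistrLatticeType]; the one-element algebra is
  allowed.  The choice structure that this type carries is no restriction:
  [boolp] provides one on every type.  [ba_leE] and [ba_meetE] relate the
  lattice order and meet to their definitions from complement and join. *)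

Lemma ba_leE d (A : ctbDistrLatticeType d) (a b : A) :
  (a <= b) <-> (~` a `|` b = \top).
Proof.
split=> [ab|ab]; first by apply/eqP; rewrite -le1x -(joinCx a) leU2.
by rewrite -[a]meetx1 -ab meetUr meetxC join0x leIr.
Qed.

Lemma ba_meetE d (A : ctbDistrLatticeType d) (a b : A) :
  a `&` b = ~` (~` a `|` ~` b).
Proof. by rewrite complU !complK. Qed.

Record pre_LP_algebra (Const Var Atom : Type) (CS : set (fm Const Var Atom))
    d (A : ctbDistrLatticeType d)
    (box : tm Const Var -> fm Const Var Atom -> A) : Prop := {
  box_app : forall s t phi psi,
    box s (FImp phi psi) `&` box t phi <= box (TApp s t) psi;
  box_sum : forall s t phi, box s phi `|` box t phi <= box (TSum s t) phi;
  box_bang : forall t phi, box t phi <= box (TBang t) (FJust t phi);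
  box_const : forall c phi, CS (FJust (TConst c) phi) ->
    box (TConst c) phi = \top }.

Fixpoint assignment (Const Var Atom : Type) d (A : ctbDistrLatticeType d)
    (box : tm Const Var -> fm Const Var Atom -> A) (theta : Atom -> A)
    (phi : fm Const Var Atom) : A :=
  match phi with
  | FAtom p => theta p
  | FBot => \bot
  | FNeg psi => ~` assignment box theta psi
  | FOr psi chi => assignment box theta psi `|` assignment box theta chi
  | FJust t psi => box t psi
  end.

Record full_LP_algebra (Const Var Atom : Type) (CS : set (fm Const Var Atom))
    d (A : ctbDistrLatticeType d)
    (box : tm Const Var -> fm Const Var Atom -> A) : Prop := {
  full_pre : pre_LP_algebra CS box;
  full_refl : forall phi t (theta : Atom -> A),
    box t phi <= assignment box theta phi }.

Record LP_isomorphism (Const Var Atom : Type)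
    d (A : ctbDistrLatticeType d) (boxA : tm Const Var -> fm Const Var Atom -> A)
    d' (B : ctbDistrLatticeType d') (boxB : tm Const Var -> fm Const Var Atom -> B)
    (f : A -> B) : Prop := {
  iso_bij : bijective f;
  iso0 : f \bot = \bot;
  isoC : forall a, f (~` a) = ~` f a;
  isoU : forall a b, f (a `|` b) = f a `|` f b;
  iso_box : forall t phi, f (boxA t phi) = boxB t phi }.

(** * Set algebras

  A set algebra on [X] is a family of subsets of [X] containing the empty set
  and closed under complement and union.  It coerces to the Boolean algebra of
  its members, a subtype of the library's power set algebra [set X]. *)

Record setAlgebra (X : Type) := SetAlgebra {
  members : set (set X);
  members0 : members set0;
  membersC : forall U, members U -> members (setC U);
  membersU : forall U V, members U -> members V -> members (setU U V) }.

Section MemberAlgebra.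
Variables (X : Type) (F : setAlgebra X).

Record member := Member { member_val : set X; _ : member_val \in members F }.

HB.instance Definition _ := [isSub for member_val].
HB.instance Definition _ := [Choice of member by <:].

Let S : {pred set X} := fun U => U \in members F.

Let memS U : U \in S <-> members F U.
Proof. by rewrite /S; split; [move/set_mem | exact: mem_set]. Qed.

Let SC U : U \in S -> (~` U)%classic \in S.
Proof. by move/memS/membersC/memS. Qed.

Let SU : join_closed S.
Proof. by move=> U V /memS SU /memS SV; apply/memS/membersU. Qed.

Let SI : meet_closed S.
Proof.
move=> U V hU hV; have -> : U `&` V = (~` (~` U `|` ~` V))%classic.
  by rewrite setCU !setCK.
by apply/SC/SU; apply: SC.
Qed.

Let S0 : (\bot : set X) \in S.
Proof. exact/memS/members0. Qed.

Let S1 : (\top : set X) \in S.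
Proof. by have := SC S0; rewrite setC0. Qed.

HB.instance Definition _ :=
  Order.SubChoice_isTBSubLattice.Build set_display (set X) S set_display member
    SI SU S0 S1.

Let memberIUl : @left_distributive member member Order.meet Order.join.
Proof. by move=> U V W; apply: val_inj; exact: (@setIUl X). Qed.

HB.instance Definition _ :=
  Order.Lattice_Meet_isDistrLattice.Build set_display member memberIUl.

Definition member_compl (U : member) : member := Member (SC (valP U)).

Let joinxC (U : member) : U `|` member_compl U = \top.
Proof. by apply: val_inj; exact: setUCr. Qed.

Let meetxC (U : member) : U `&` member_compl U = \bot.
Proof. by apply: val_inj; exact: setICr. Qed.

HB.instance Definition _ :=
  Order.TBDistrLattice_hasComplement.Build set_display member joinxC meetxC.

Lemma member_val0 : member_val \bot = set0.
Proof. by []. Qed.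

Lemma member_valC (U : member) : member_val (~` U) = setC (member_val U).
Proof. by []. Qed.

Lemma member_valU (U V : member) :
  member_val (U `|` V) = setU (member_val U) (member_val V).
Proof. by []. Qed.

End MemberAlgebra.

Coercion setAlgebra_type (X : Type) (F : setAlgebra X) :
  ctbDistrLatticeType set_display := member F.

(* Main.v *)
Require Import Defs.
From mathcomp Require Import all_boot all_order.
From mathcomp Require Import boolp classical_sets.

(** The Boolean part is Stone's representation theorem.  Full LP algebras
  transport along any Boolean isomorphism [f] by setting [box := f \o boxA]:
  as [f] is onto, every valuation in the target is [f \o theta] for some
  valuation [theta] in the source, so the reflection condition, which
  quantifies over all valuations, is transported as well. *)

Set Implicit Arguments.
Unset Strict Implicit.
Unset Printing Implicit Defensive.

Import Order.Theory.
Local Open Scope order_scope.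

Section Transport.
Variables (Const Var Atom : Type) (CS : set (fm Const Var Atom)).
Variables (d d' : Order.disp_t).
Variables (A : ctbDistrLatticeType d) (B : ctbDistrLatticeType d').
Variable f : A -> B.
Hypotheses (f_bij : bijective f) (f0 : f \bot = \bot).
Hypothesis fC : forall a, f (~` a) = ~` f a.
Hypothesis fU : forall a b, f (a `|` b) = f a `|` f b.

Let f_le a b : a <= b -> f a <= f b.
Proof. by move=> /join_idPl ab; rewrite -ab fU leUr. Qed.

Let fI a b : f (a `&` b) = f a `&` f b.
Proof. by rewrite !ba_meetE fC fU !fC. Qed.

Variable boxA : tm Const Var -> fm Const Var Atom -> A.

(** At [FJust] both sides reduce to [f (boxA t psi)], since [assignment] does not descend below a
    justification. *)
Lemma assignment_transport (theta : Atom -> A) phi :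
  f (assignment boxA theta phi) =
  assignment (fun t psi => f (boxA t psi)) (f \o theta) phi.
Proof.
by elim: phi => //= [phi <-|phi <- psi <-]; [exact: fC | exact: fU].
Qed.

Lemma full_LP_algebra_transport :
  full_LP_algebra CS boxA ->
  full_LP_algebra CS (fun t phi => f (boxA t phi)).
Proof.
case=> -[app sum bang const] refl; split; first split.
- by move=> s t phi psi; rewrite -fI; apply: f_le; exact: app.
- by move=> s t phi; rewrite -fU; apply: f_le; exact: sum.
- by move=> t phi; apply: f_le; exact: bang.
- by move=> c phi /const ->; rewrite -compl0 fC f0 compl0.
move=> phi t theta; have [g fK gK] := f_bij.
have -> : theta = f \o (g \o theta) by apply/funext => p /=; rewrite gK.
by rewrite -assignment_transport; apply: f_le; exact: refl.
Qed.

End Transport.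

Section Stone.
Variables (d : Order.disp_t) (A : ctbDistrLatticeType d).

(** Encoded as a Boolean homomorphism to truth values; closure upwards and under meets follows from
    the two fields. *)
Record ultrafilter := Ultrafilter {
  umem :> A -> Prop;
  umemC : forall a, umem (~` a) <-> ~ umem a;
  umemU : forall a b, umem (a `|` b) <-> umem a \/ umem b }.

Lemma umem0 (U : ultrafilter) : ~ U \bot.
Proof.
move=> U0; have /umemC// : U (~` \bot).
by rewrite compl0 -(joinx1 \bot); apply/umemU; left.
Qed.

Section Extension.
Variable c : A.

(* The empty set satisfies this, as Zorn's lemma for unions of chains
   requires: [\top \in G] is not imposed, and [c] need not belong to [G]. *)
Let compatible (G : set A) := [/\ forall x y, G x -> G y -> G (x `&` y),
  forall x y, G x -> x <= y -> G y & forall x, G x -> x `&` c <> \bot].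

(** Only closure under meets involves two elements, and these lie in a common member of the
    chain. *)
Let compatible_bigcup (C : set (set A)) :
  (C `<=` compatible)%classic -> total_on C subset ->
  compatible (\bigcup_(G in C) G)%classic.
Proof.
move=> Cc Ctot; split.
- move=> x y [G CG Gx] [H CH Hy].
  have [GH|HG] := Ctot G H CG CH.
  + by exists H => //; have [HI _ _] := Cc H CH; apply: HI => //; exact: GH.
  + by exists G => //; have [GI _ _] := Cc G CG; apply: GI => //; exact: HG.
- move=> x y [G CG Gx] xy; exists G => //.
  by have [_ Gle _] := Cc G CG; exact: Gle xy.
- by move=> x [G CG Gx]; have [_ _ Gc] := Cc G CG; exact: Gc.
Qed.

(** Otherwise the filter generated by [G] and [a] would be a strictly larger compatible set. *)
Let maximal_mem (G : set A) : compatible G ->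
  (forall H, (G `<` H)%classic -> ~ compatible H) ->
  forall a, (forall g, g = \top \/ G g -> g `&` a `&` c <> \bot) -> G a.
Proof.
move=> [GI Gle Gc] Gmax a ac; apply: contrapT => nGa.
(* [G] is not yet known to contain [\top]; adjoining it puts [a] itself into the larger set. *)
pose T g := g = \top \/ G g.
have TI g h : T g -> T h -> T (g `&` h).
  by move=> [->|Gg] [->|Gh]; rewrite /T ?meet1x ?meetx1; auto.
apply: (Gmax [set x | exists2 g, T g & (g `&` a <= x)%O]%classic).
  rewrite properEneq; split.
    apply/eqP => GE; apply: nGa; rewrite GE.
    by exists \top; [left | rewrite meet1x].
  by move=> x Gx; exists x; [right | exact: leIl].
split.
- move=> x y [g Tg gx] [h Th hy]; exists (g `&` h); first exact: TI.
  rewrite lexI (le_trans _ gx) ?(le_trans _ hy) //.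
  + by rewrite leI2 ?leIr.
  + by rewrite leI2 ?leIl.
- by move=> x y [g Tg gx] xy; exists g => //; exact: le_trans gx xy.
- move=> x [g Tg gx] xc; apply: (ac g Tg); apply/eqP.
  by rewrite -lex0 -xc leI2.
Qed.

(** A maximal compatible set contains [\top] and [c], and maximality makes it decide every
    element. *)
Lemma ultrafilter_exists : c != \bot -> exists U : ultrafilter, U c.
Proof.
move=> /eqP c0; have [G [Gcomp Gmax]] := Zorn_bigcup compatible_bigcup.
have Gin := maximal_mem Gcomp Gmax; have [GI Gle Gc] := Gcomp.
have TGc g : g = \top \/ G g -> g `&` c <> \bot.
  by move=> [->|/Gc //]; rewrite meet1x.
have Gtop : G \top by apply: Gin => g; rewrite meetx1; exact: TGc.
have Gnot a : ~ G a -> exists2 g, G g & g `&` a `&` c = \bot.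
  move=> nGa; apply: contrapT => nE; apply: nGa; apply: Gin => g Tg gac.
  by apply: nE; exists g => //; case: Tg => [->|].
have GC a : G (~` a) <-> ~ G a.
  split=> [GCa Ga|/Gnot[g Gg gac]].
    by apply: (Gc _ (GI _ _ Ga GCa)); rewrite meetxC meet0x.
  apply: contrapT => /Gnot[h Gh hac]; apply: (Gc _ (GI _ _ Gg Gh)).
  (* Split the meet of [g], [h] and [c] along [a] and its complement: the two pieces lie below the
     meets in [gac] and [hac], both [\bot]. *)
  apply/eqP; rewrite -lex0 -(meetx1 (_ `&` c)) -(joinxC a) meetUr leUx.
  apply/andP; split.
  - by rewrite (meetAC _ c) -gac; apply: leI2 => //; apply: leI2 => //; exact: leIl.
  - by rewrite (meetAC _ c) -hac; apply: leI2 => //; apply: leI2 => //; exact: leIr.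
have GU a b : G (a `|` b) <-> G a \/ G b.
  split=> [Gab|[Ga|Gb]]; last 2 first.
  - by apply: Gle Ga _; exact: leUl.
  - by apply: Gle Gb _; exact: leUr.
  (* If [G] has neither [a] nor [b], it has both complements, hence by De Morgan the complement of
     the join. *)
  apply: contrapT => /not_orP[/GC Ga /GC Gb].
  by apply: (proj1 (GC (a `|` b))) => //; rewrite complU; exact: GI.
exists (Ultrafilter GC GU) => /=.
by apply: Gin => g /TGc; rewrite -meetA meetxx.
Qed.

End Extension.

Definition stone (a : A) : set ultrafilter := [set U | U a]%classic.

Lemma stone0 : stone \bot = set0.
Proof. by apply/seteqP; split=> // U /umem0. Qed.

Lemma stoneC a : stone (~` a) = (~` stone a)%classic.
Proof. by apply/funext => U; apply/propext; exact: umemC. Qed.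

Lemma stoneU a b : stone (a `|` b) = (stone a `|` stone b)%classic.
Proof. by apply/funext => U; apply/propext; exact: umemU. Qed.

Lemma stone_le a b : (stone a `<=` stone b)%classic -> a <= b.
Proof.
move=> ab; apply: contrapT => nab.
(* An ultrafilter through this element contains [a] but not [b]. *)
have /ultrafilter_exists[U] : a `&` ~` b != \bot.
  apply/eqP => ab0; apply: nab; apply/ba_leE.
  by apply: compl_inj; rewrite complU complK compl1.
rewrite ba_meetE complK => /umemC nU.
by apply/nU/umemU; case: (pselect (U a)) => [/ab|/umemC]; auto.
Qed.

Lemma stone_inj : injective stone.
Proof.
by move=> a b ab; apply/eqP; rewrite eq_le !stone_le ?ab.
Qed.

(** Kept transparent so that [members] reduces to [range stone], as [stone_map] requires. *)
Definition stone_algebra : setAlgebra ultrafilter.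
Proof.
exists (range stone).
- by exists \bot => //; exact: stone0.
- by move=> _ [a _ <-]; exists (~` a) => //; exact: stoneC.
- by move=> _ _ [a _ <-] [b _ <-]; exists (a `|` b) => //; exact: stoneU.
Defined.

Definition stone_map (a : A) : stone_algebra :=
  Member (mem_set (imageT stone a) : stone a \in members stone_algebra).

Lemma stone_map_bij : bijective stone_map.
Proof.
(* Choice turns the existence of preimages into an inverse function. *)
have stone_map_surj (V : stone_algebra) : {a | stone_map a = V}.
  apply: cid; case: V => V hV; have [a _ aV] := set_mem hV.
  by exists a; apply: val_inj.
exists (fun V => sval (stone_map_surj V)) => [a|V].
  by case: stone_map_surj => b ba; apply: stone_inj; exact: (congr1 (@member_val _ _) ba).
by case: stone_map_surj.
Qed.

Lemma stone_map0 : stone_map \bot = \bot.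
Proof. by apply: val_inj; exact: stone0. Qed.

Lemma stone_mapC a : stone_map (~` a) = ~` stone_map a.
Proof. by apply: val_inj; exact: stoneC. Qed.

Lemma stone_mapU a b : stone_map (a `|` b) = stone_map a `|` stone_map b.
Proof. by apply: val_inj; exact: stoneU. Qed.

End Stone.

Theorem theorem4p11 (Const Var Atom : Type) (CS : set (fm Const Var Atom))
    (hCS : constant_specification CS)
    (d : Order.disp_t) (A : ctbDistrLatticeType d)
    (boxA : tm Const Var -> fm Const Var Atom -> A)
    (hA : full_LP_algebra CS boxA) :
  exists (X : Type) (F : setAlgebra X)
         (boxF : tm Const Var -> fm Const Var Atom -> F),
    full_LP_algebra CS boxF /\
    exists f : A -> F, LP_isomorphism boxA boxF f.
Proof.
have bij := stone_map_bij A; have m0 := stone_map0 A.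
have mC := @stone_mapC _ A; have mU := @stone_mapU _ A.
(* With the boxes copied along [stone_map], [iso_box] holds by definition. *)
exists (ultrafilter A), (stone_algebra A), (fun t phi => stone_map (boxA t phi)).
split; first exact: full_LP_algebra_transport.
by exists (@stone_map _ A); split.
Qed.
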